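(* Let $0<\kappa_{\min}<\kappa_{\max}$ be real numbers and let $M\ge 1$ be an integer. Define $$\omega_n = 2\left[\kappa_{\max}+\kappa_{\min}-(\kappa_{\max}-\kappa_{\min})\cos\left(\pi\frac{2n-1}{2M}\right)\right]^{-1},\qquad n=1,\ldots,M,$$ and let $G_M(\kappa)=\prod_{n=1}^{M}(1-\omega_n\kappa)$ be the total amplification factor of the SRJ scheme with $P=M$ that uses each of the weights $\omega_1,\dots,\omega_M$ exactly once per cycle. Let $T_M$ be the Chebyshev polynomial of the first kind of degree $M$. Then, for all $\kappa$, $$G_M(\kappa)=\frac{T_M(\tilde\kappa(\kappa))}{T_M(\tilde\kappa(0))},\qquad \tilde\kappa(\kappa)=2\,\frac{\kappa-\kappa_{\min}}{\kappa_{\max}-\kappa_{\min}}-1,\qquad \tilde\kappa(0)=-\frac{1+\kappa_{\min}/\kappa_{\max}}{1-\kappa_{\min}/\kappa_{\max}}<-1,$$ and this scheme is optimal among all SRJ schemes with $M$ iterations per cycle: for every integer $P$ with $1\le P\le M$, all pairwise distinct real weights $\omega'_1,\ldots,\omega'_P$, and all positive integers $q_1,\ldots,q_P$ with $\sum_{n=1}^P q_n=M$, the amplification factor $G'(\kappa)=\prod_{n=1}^{P}(1-\omega'_n\kappa)^{q_n}$ satisfies $$\max_{\kappa\in[\kappa_{\min},\kappa_{\max}]}|G'(\kappa)|\;\ge\;\max_{\kappa\in[\kappa_{\min},\kappa_{\max}]}|G_M(\kappa)|,$$ with strict inequality whenever $G'\ne G_M$ as polynomials; in particular, the inequality is strict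 whenever $P<M$.
   Context: The Scheduled Relaxation Jacobi (SRJ) method for a linear system $Au=b$ with $D=\mathrm{diag}(A)$ is the iteration $u^{n+1}=u^n+\omega_n D^{-1}(b-Au^n)$. An SRJ scheme with $P$ distinct real relaxation factors (weights) $\omega_1,\dots,\omega_P$, the weight $\omega_n$ being applied $q_n\ge 1$ times, has $M=\sum_{n=1}^P q_n$ iterations per cycle and total amplification factor $G_M(\kappa)=\prod_{n=1}^P(1-\omega_n\kappa)^{q_n}$, viewed as a polynomial in the real variable $\kappa\in[\kappa_{\min},\kappa_{\max}]$. For a fixed $M$, a scheme is optimal if it minimizes the maximum of $|G_M(\kappa)|$ over $\kappa\in[\kappa_{\min},\kappa_{\max}]$. The Chebyshev polynomial of the first kind $T_M$ is defined by $T_M(\cos\theta)=\cos(M\theta)$. *)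

(* Defs.v *)
From mathcomp Require Import all_boot all_order all_algebra.
From mathcomp Require Import all_classical all_reals all_analysis.
From mathcomp Require Import ring lra.

Set Implicit Arguments.
Unset Strict Implicit.
Unset Printing Implicit Defensive.

Import Order.TTheory GRing.Theory Num.Theory.
Import numFieldNormedType.Exports.

Local Open Scope classical_set_scope.
Local Open Scope ring_scope.

Definition is_chebyshevT (R : realType) (M : nat) (T : {poly R}) : Prop :=
  forall theta : R, T.[cos theta] = cos (M%:R * theta).

(* The defining identity determines exactly one polynomial. *)
Lemma is_chebyshevT_ex (R : realType) (M : nat) :
  exists T : {poly R}, is_chebyshevT M T.
Proof.
suff [T [S [hT _]]] : exists T S : {poly R},
    is_chebyshevT M T /\ is_chebyshevT M.+1 S by exists T.
elim: M => [|M [T [S [hT hS]]]].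
  exists 1, 'X; split=> t; first by rewrite hornerC mul0r cos0.
  by rewrite hornerX mul1r.
exists S, (2%:R *: ('X * S) - T); split => // t.
rewrite hornerD hornerN hornerZ hornerM hornerX hT hS.
have -> : M.+2%:R * t = M.+1%:R * t + t by rewrite -[M.+2]addn1 natrD; ring.
have -> : M%:R * t = M.+1%:R * t - t by rewrite -[M.+1]addn1 natrD; ring.
by rewrite cosB cosD; ring.
Qed.

Lemma is_chebyshevT_uniq (R : realType) (M : nat) (T S : {poly R}) :
  is_chebyshevT M T -> is_chebyshevT M S -> T = S.
Proof.
move=> hT hS; apply/eqP; rewrite -subr_eq0; apply/eqP.
have root_itv (x : R) : -1 <= x <= 1 -> root (T - S) x.
  move=> hx; have <- : cos (acos x) = x by rewrite acosK// in_itv.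
  by rewrite rootE hornerD hornerN hT hS subrr.
pose f (i : nat) : R := i.+1%:R^-1.
apply: (@roots_geq_poly_eq0 _ _ [seq f i | i <- iota 0 (size (T - S))]).
- apply/allP => _ /mapP[i _ ->]; apply: root_itv.
  rewrite invf_le1 ?ltr0n// ler1n andbT.
  by rewrite (le_trans (lerN10 _))// invr_ge0 ler0n.
- rewrite map_inj_uniq ?iota_uniq// => i j /invr_inj/eqP.
  by rewrite eqr_nat => /eqP[].
- by rewrite size_map size_iota.
Qed.

(* The maximum of |p| over [a, b]; see max_abs_attained. *)
Definition max_abs (R : realType) (a b : R) (p : {poly R}) : R :=
  sup [set `|p.[k]| | k in `[a, b]].

Lemma max_abs_attained (R : realType) (a b : R) (p : {poly R}) : a <= b ->
  (exists2 k, k \in `[a, b] & `|p.[k]| = max_abs a b p) /\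
  (forall k, k \in `[a, b] -> `|p.[k]| <= max_abs a b p).
Proof.
move=> ab.
have [|c cab maxc] := @EVT_max R (fun k => `|p.[k]|) a b ab.
  apply: continuous_subspaceT => k.
  by apply: cvg_norm; exact: continuous_horner.
have ubc : ubound [set `|p.[k]| | k in `[a, b]] `|p.[c]|.
  by move=> _ [k kab <-]; exact: maxc.
have maxE : `|p.[c]| = max_abs a b p.
  apply/eqP; rewrite eq_le; apply/andP; split.
    by apply: ub_le_sup; [exists `|p.[c]| | exists c].
  by apply: ge_sup => //; exists `|p.[c]|; exists c.
by split; [exists c | move=> k kab; rewrite -maxE; exact: maxc].
Qed.

(* P distinct weights, the weight w n being applied q n times in each cycle
   of M iterations. *)
Definition srj_scheme (R : realType) (M P : nat)
    (w : 'I_P -> R) (q : 'I_P -> nat) : Prop :=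
  [/\ (1 <= P <= M)%N, injective w, forall n, (1 <= q n)%N
    & (\sum_n q n)%N = M].

Definition srj_amplification (R : realType) (P : nat)
    (w : 'I_P -> R) (q : 'I_P -> nat) : {poly R} :=
  \prod_n (1 - w n *: 'X) ^+ q n.

Definition srj_optimal (R : realType) (kmin kmax : R) (M P : nat)
    (w : 'I_P -> R) (q : 'I_P -> nat) : Prop :=
  srj_scheme M w q /\
  forall (P' : nat) (w' : 'I_P' -> R) (q' : 'I_P' -> nat),
    srj_scheme M w' q' ->
    max_abs kmin kmax (srj_amplification w q) <=
    max_abs kmin kmax (srj_amplification w' q').

(* 'I_M is numbered from 0: the index n stands for the (n+1)-st weight. *)
Definition chebyshev_weight (R : realType) (kmin kmax : R) (M : nat)
    (n : 'I_M) : R :=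
  2 * (kmax + kmin
       - (kmax - kmin) * cos (pi * ((2 * n.+1%:R - 1) / (2 * M%:R))))^-1.

Definition kappa_tilde (R : realType) (kmin kmax k : R) : R :=
  2 * ((k - kmin) / (kmax - kmin)) - 1.

(* Main.v *)
Require Import Defs.
From mathcomp Require Import all_boot all_order all_algebra.
From mathcomp Require Import all_classical all_reals all_analysis.
From mathcomp Require Import ring lra.

Set Implicit Arguments.
Unset Strict Implicit.
Unset Printing Implicit Defensive.

Import Order.TTheory GRing.Theory Num.Theory.
Local Open Scope ring_scope.

(** G and the normalized shifted Chebyshev polynomial have degree at most M,
    value 1 at 0 and the common zeros 1 / w n, so they are equal.  Hence on
    [kmin, kmax] the polynomial G equioscillates: it takes the values
    +/- max |G|, with alternating signs, at the M + 1 images of the Chebyshev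
    extrema.  If max |G'| <= max |G|, then G - G' has weakly alternating signs
    at these points, has degree at most M, and vanishes at 0.  The points are
    positive, so the Lagrange basis polynomials also alternate in sign at 0; all
    terms of the interpolation formula for (G - G')(0) = 0 thus have the same
    sign, hence vanish, and G = G'. *)

(** * Signs of Lagrange basis polynomials at 0 *)

Lemma prodr_sign_lt (R : pzRingType) (n : nat) (i : 'I_n) :
  \prod_(j < n | j != i) (-1) ^+ (j < i)%N = (-1) ^+ i :> R.
Proof.
rewrite prodrXr; congr (_ ^+ _).
(* The omitted index [j = i] contributes 0, so the exponent counts all indices below [i]. *)
have : (\sum_(j < n) (j < i) = (i < i) + \sum_(j < n | j != i) (j < i))%N.
  by rewrite (bigD1 i).
rewrite ltnn add0n => <-.
rewrite -big_mkcond /= -(big_ord_widen n (fun=> 1%N)) ?(ltnW (ltn_ord i)) //.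
by rewrite sum1_card card_ord.
Qed.

(** At 0 the basis polynomial is the product over [j != i] of [- x j / (x i - x j)]; with positive
    increasing nodes, a factor is negative exactly when [j < i]. *)
Lemma lagrange0_sign (R : realFieldType) (n : nat) (x : nat -> R) (i : 'I_n) :
  injective x -> (forall j k, (j < k < n)%N -> x j < x k) ->
  (forall j, (j < n)%N -> 0 < x j) ->
  0 < (-1) ^+ i * (tnth (n.-lagrange x) i : {poly R}).[0].
Proof.
move=> x_inj x_lt x_gt0.
have n_gt0 : (0 < n)%N := leq_ltn_trans (leq0n _) (ltn_ord i).
rewrite lagrangeE //= hornerM hornerC !horner_prod -prodfV -big_split /=.
rewrite -prodr_sign_lt -big_split /=; apply: prodr_gt0 => j ji.
rewrite !hornerXsubC sub0r; have xj_gt0 := x_gt0 j (ltn_ord j).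
have [lt_ji|le_ij] := ltnP j i.
  have xji : x j < x i by rewrite x_lt // lt_ji ltn_ord.
  by rewrite expr1 mulN1r mulrN opprK mulr_gt0 // invr_gt0 subr_gt0.
have xij : x i < x j.
  by rewrite x_lt // ltn_ord andbT ltn_neqAle le_ij eq_sym (inj_eq val_inj) ji.
by rewrite expr0 mul1r nmulr_rgt0 ?invr_lt0 ?subr_lt0 // oppr_lt0.
Qed.

(** Evaluating the interpolation formula at 0 copes with weak inequalities directly, where counting
    sign changes would call for root multiplicities. *)
Lemma alternating_poly_eq0 (R : realFieldType) (n : nat) (x : nat -> R)
    (p : {poly R}) :
  (0 < n)%N -> (size p <= n)%N ->
  (forall j k, (j < k < n)%N -> x j < x k) ->
  (forall j, (j < n)%N -> 0 < x j) ->
  (forall j, (j < n)%N -> 0 <= (-1) ^+ j * p.[x j]) ->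
  p.[0] = 0 -> p = 0.
Proof.
move=> n_gt0 size_p x_lt x_gt0 p_alt p0.
(* [lagrange] requires nodes that are injective on all of nat. *)
pose y j : R := if (j < n)%N then x j else - j%:R.
have yE j : (j < n)%N -> y j = x j by rewrite /y => ->.
have y_inj : injective y.
  have xN j k : (j < n)%N -> x j = - k%:R -> False.
    move=> /x_gt0 + xE; rewrite xE oppr_gt0 ltNge ler0n //.
  move=> j k; rewrite /y; case: ifPn => [jn|_]; case: ifPn => [kn|_].
  - move=> xE; case: (ltngtP j k) => // [jk|kj].
      by have := x_lt j k; rewrite jk kn xE ltxx => /(_ isT).
    by have := x_lt k j; rewrite kj jn xE ltxx => /(_ isT).
  - by move/xN => /(_ jn).
  - by move/esym/xN => /(_ kn).
  - by move/oppr_inj/eqP; rewrite eqr_nat => /eqP.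
have L_sign (i : 'I_n) : 0 < (-1) ^+ i * (tnth (n.-lagrange y) i : {poly R}).[0].
  apply: lagrange0_sign => // [j k /andP[jk kn]|j jn].
    by rewrite !yE ?x_lt ?jk // (ltn_trans jk).
  by rewrite yE ?x_gt0.
have := lagrange_gen n_gt0 y_inj size_p => pE.
have sum0 : \sum_(i < n) p.[y i] * (tnth (n.-lagrange y) i : {poly R}).[0] = 0.
  rewrite -[RHS]p0 [in RHS]pE horner_sum; apply: eq_bigr => i _.
  by rewrite hornerM hornerC.
have term_ge0 (i : 'I_n) :
    true -> 0 <= p.[y i] * (tnth (n.-lagrange y) i : {poly R}).[0].
  move=> _; have := mulr_ge0 (p_alt i (ltn_ord i)) (ltW (L_sign i)).
  (* The alternating signs of the value and of the basis polynomial cancel. *)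
  by rewrite mulrACA -expr2 sqrr_sign mul1r yE.
rewrite pE big1 // => i _.
have /eqP := psumr_eq0P term_ge0 sum0 (i := i) isT.
rewrite mulf_eq0 => /orP[/eqP->|/eqP L0]; first by rewrite mul0r.
by have := L_sign i; rewrite L0 mulr0 ltxx.
Qed.

(** * Chebyshev polynomials: degree, reflection, bound *)

(** The three-term recurrence builds a polynomial with this bound, carrying consecutive pairs
    through the induction; uniqueness transfers the bound to [T]. *)
Lemma is_chebyshevT_size (R : realType) (M : nat) (T : {poly R}) :
  is_chebyshevT M T -> (size T <= M.+1)%N.
Proof.
suff [U [V [hU _ sU _]]] : exists U V : {poly R},
    [/\ is_chebyshevT M U, is_chebyshevT M.+1 V,
        (size U <= M.+1)%N & (size V <= M.+2)%N].
  by move=> hT; rewrite (is_chebyshevT_uniq hT hU).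
elim: M {T} => [|M [U [V [hU hV sU sV]]]].
  exists 1, 'X; rewrite size_poly1 size_polyX; split=> // t.
    by rewrite hornerC mul0r cos0.
  by rewrite hornerX mul1r.
exists V, (2%:R *: ('X * V) - U); split => // [t|].
  rewrite hornerD hornerN hornerZ hornerM hornerX hU hV.
  have -> : M.+2%:R * t = M.+1%:R * t + t by rewrite -[M.+2]addn1 natrD; ring.
  have -> : M%:R * t = M.+1%:R * t - t by rewrite -[M.+1]addn1 natrD; ring.
  by rewrite cosB cosD; ring.
apply: leq_trans (size_polyD _ _) _; rewrite size_polyN geq_max.
apply/andP; split; last by apply: leq_trans sU _; rewrite !ltnS -addn2 leq_addr.
apply: leq_trans (size_scale_leq _ _) _.
by apply: leq_trans (size_polyMleq _ _) _; rewrite size_polyX.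
Qed.

Lemma is_chebyshevT_cosN (R : realType) (M : nat) (T : {poly R}) (t : R) :
  is_chebyshevT M T -> T.[- cos t] = (-1) ^+ M * cos (M%:R * t).
Proof.
move=> hT; have -> : - cos t = cos (pi - t).
  by rewrite cosB cospi sinpi mul0r addr0 mulN1r.
rewrite hT; have -> : M%:R * (pi - t) = - (M%:R * t) + pi *+ M.
  by rewrite -mulr_natl; ring.
by rewrite (alternatingn (@cosDpi R)) cosN.
Qed.

Lemma is_chebyshevT_norm_le1 (R : realType) (M : nat) (T : {poly R}) (x : R) :
  is_chebyshevT M T -> -1 <= x <= 1 -> `|T.[x]| <= 1.
Proof.
move=> hT x_itv; rewrite -[x]acosK ?in_itv // hT.
exact: cos_max.
Qed.

(** * Chebyshev nodes in the spectral interval *)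

(* The inverse image under [kappa_tilde] of [- c]. *)
Definition kappa_node (R : realType) (kmin kmax c : R) : R :=
  (kmax + kmin - (kmax - kmin) * c) / 2.

(** The cosines of these angles for [n < M] are the roots of the Chebyshev polynomial; the body
    repeats the cosine argument of [chebyshev_weight]. *)
Definition chebyshev_angle (R : realType) (M n : nat) : R :=
  pi * ((2 * n.+1%:R - 1) / (2 * M%:R)).

Lemma kappa_nodeK (R : realType) (kmin kmax c : R) : kmin < kmax ->
  kappa_tilde kmin kmax (kappa_node kmin kmax c) = - c.
Proof.
move=> lt_k; have : kmax - kmin != 0 by rewrite subr_eq0 gt_eqF.
by rewrite /kappa_tilde /kappa_node => ?; field.
Qed.

Lemma kappa_node_itv (R : realType) (kmin kmax c : R) : kmin < kmax ->
  -1 <= c <= 1 -> kmin <= kappa_node kmin kmax c <= kmax.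
Proof. by move=> lt_k /andP[c_ge c_le]; rewrite /kappa_node; nra. Qed.

Lemma ltr_kappa_node (R : realType) (kmin kmax c d : R) : kmin < kmax ->
  (kappa_node kmin kmax c < kappa_node kmin kmax d) = (d < c).
Proof.
move=> lt_k; rewrite /kappa_node ltr_pM2r ?invr_gt0 ?ltr0n // ltrD2l ltrN2.
by rewrite ltr_pM2l // subr_gt0.
Qed.

Lemma kappa_node_inj (R : realType) (kmin kmax : R) : kmin < kmax ->
  injective (kappa_node kmin kmax).
Proof.
move=> lt_k c d /(congr1 (kappa_tilde kmin kmax)).
by rewrite !kappa_nodeK // => /oppr_inj.
Qed.

Lemma kappa_tilde_itv (R : realType) (kmin kmax k : R) : kmin < kmax ->
  kmin <= k <= kmax -> -1 <= kappa_tilde kmin kmax k <= 1.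
Proof.
move=> lt_k /andP[k_ge k_le]; have d_gt0 : 0 < kmax - kmin by rewrite subr_gt0.
have : 0 <= (k - kmin) / (kmax - kmin) <= 1.
  by rewrite ler_pdivlMr // ler_pdivrMr // mul0r mul1r subr_ge0 k_ge lerB.
by rewrite /kappa_tilde; lra.
Qed.

(** This exhibits the nodes as the roots of the factors of the amplification polynomial. *)
Lemma chebyshev_weightE (R : realType) (kmin kmax : R) (M : nat) (n : 'I_M) :
  chebyshev_weight kmin kmax n =
  (kappa_node kmin kmax (cos (chebyshev_angle R M n)))^-1.
Proof. by rewrite invf_div. Qed.

Lemma chebyshev_angle_itv (R : realType) (M : nat) (n : 'I_M) :
  0 <= chebyshev_angle R M n <= pi.
Proof.
have M_gt0 : 0 < 2 * M%:R :> R.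
  by rewrite mulr_gt0 ?ltr0n // (leq_ltn_trans (leq0n _) (ltn_ord n)).
have n_ge0 : 0 <= n%:R :> R by rewrite ler0n.
have n_lt : n.+1%:R <= M%:R :> R by rewrite ler_nat ltn_ord.
have n1E : n.+1%:R = n%:R + 1 :> R by rewrite -addn1 natrD.
have pi_ge0 := pi_ge0 R.
have frac_itv : 0 <= (2 * n.+1%:R - 1 : R) / (2 * M%:R) <= 1.
  by rewrite ler_pdivlMr // ler_pdivrMr //; lra.
by case/andP: frac_itv => ? ?; rewrite mulr_ge0 //= ler_piMr.
Qed.

Lemma chebyshev_angle_inj (R : realType) (M : nat) : (0 < M)%N ->
  injective (chebyshev_angle R M).
Proof.
move=> M_gt0 j k /(mulfI (lt0r_neq0 (pi_gt0 R))).
have M_neq0 : 2 * M%:R != 0 :> R by rewrite mulf_neq0 ?pnatr_eq0 -?lt0n.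
move=> /(divIf M_neq0)/addIr/mulfI; rewrite pnatr_eq0 => /(_ isT)/eqP.
by rewrite eqr_nat => /eqP[].
Qed.

Lemma cos_chebyshev_angle (R : realType) (M n : nat) : (0 < M)%N ->
  cos (M%:R * chebyshev_angle R M n) = 0.
Proof.
move=> M_gt0; have M_neq0 : M%:R != 0 :> R by rewrite pnatr_eq0 -lt0n.
(* An odd multiple of [pi / 2], where cosine vanishes. *)
have -> : M%:R * chebyshev_angle R M n = pi / 2 + pi *+ n.
  by rewrite -mulr_natl /chebyshev_angle -addn1 natrD; field.
by rewrite (alternatingn (@cosDpi R)) cos_pihalf mulr0.
Qed.

(** The angles are distinct and lie in [0, pi], where cosine is injective. *)
Lemma kappa_node_cos_inj (R : realType) (kmin kmax : R) (M : nat) :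
  kmin < kmax ->
  injective (fun n : 'I_M => kappa_node kmin kmax (cos (chebyshev_angle R M n))).
Proof.
move=> lt_k j k /kappa_node_inj - /(_ lt_k).
have M_gt0 : (0 < M)%N := leq_ltn_trans (leq0n _) (ltn_ord j).
move=> /cos_inj; rewrite !in_itv /= !chebyshev_angle_itv => /(_ isT isT).
by move=> /(chebyshev_angle_inj M_gt0)/val_inj.
Qed.

Lemma kappa_node_cos_gt0 (R : realType) (kmin kmax t : R) :
  0 < kmin -> kmin < kmax -> 0 < kappa_node kmin kmax (cos t).
Proof.
move=> kmin_gt0 lt_k; apply: lt_le_trans kmin_gt0 _.
by have /andP[] := kappa_node_itv lt_k (introT andP (conj (cos_geN1 t) (cos_le1 t))).
Qed.

Lemma chebyshev_weight_inj (R : realType) (kmin kmax : R) (M : nat) :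
  kmin < kmax -> injective (chebyshev_weight kmin kmax (M := M)).
Proof.
move=> lt_k j k; rewrite !chebyshev_weightE => /invr_inj.
exact: kappa_node_cos_inj.
Qed.

(** The [M] distinct nodes are positive, so together with 0 they form [M + 1] roots, too many for
    degree at most [M]. *)
Lemma poly_eq0_at_nodes (R : realType) (kmin kmax : R) (M : nat)
    (p : {poly R}) :
  0 < kmin -> kmin < kmax -> (size p <= M.+1)%N -> p.[0] = 0 ->
  (forall n : 'I_M, p.[kappa_node kmin kmax (cos (chebyshev_angle R M n))] = 0) ->
  p = 0.
Proof.
move=> kmin_gt0 lt_k size_p p0 p_node.
pose node (n : 'I_M) := kappa_node kmin kmax (cos (chebyshev_angle R M n)).
apply: (@roots_geq_poly_eq0 _ p (0 :: [seq node n | n : 'I_M])).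
- rewrite /= rootE p0 eqxx; apply/allP => _ /mapP[n _ ->].
  by rewrite rootE p_node.
- rewrite /= map_inj_uniq ?enum_uniq ?andbT; last exact: kappa_node_cos_inj.
  apply/mapP => -[n _ /esym/eqP]; apply/negP.
  by rewrite gt_eqF // kappa_node_cos_gt0.
- by rewrite /= size_map size_enum_ord.
Qed.

(** * Amplification polynomials of SRJ schemes *)

Lemma size_srj_amplification (R : realType) (P : nat) (w : 'I_P -> R)
    (q : 'I_P -> nat) :
  (size (srj_amplification w q) <= (\sum_n q n).+1)%N.
Proof.
rewrite /srj_amplification.
apply: (big_ind2 (fun (p : {poly R}) m => size p <= m.+1)%N) => [||n _].
- by rewrite size_poly1.
- move=> p m p' m' sp sp'; apply: leq_trans (size_polyMleq _ _) _.
  by rewrite -ltnS -addSn -addnS; case: (size p + _)%N (leq_add sp sp').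
- apply: leq_trans (size_poly_exp_leq _ _) _; rewrite ltnS -[leqRHS]mul1n.
  rewrite leq_mul2r; apply/orP; right; rewrite -ltnS.
  suff size_lin : (size ((1 - w n *: 'X)%R : {poly R}) <= 2)%N.
    by case: (size _) size_lin.
  apply: leq_trans (size_polyD _ _) _; rewrite size_polyN geq_max size_poly1 /=.
  by apply: leq_trans (size_scale_leq _ _) _; rewrite size_polyX.
Qed.

Lemma horner_srj_amplification (R : realType) (P : nat) (w : 'I_P -> R)
    (q : 'I_P -> nat) (k : R) :
  (srj_amplification w q).[k] = \prod_n (1 - w n * k) ^+ q n.
Proof.
rewrite horner_prod; apply: eq_bigr => n _.
by rewrite horner_exp hornerD hornerN hornerZ hornerX hornerC.
Qed.

Lemma srj_amplification0 (R : realType) (P : nat) (w : 'I_P -> R)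
    (q : 'I_P -> nat) : (srj_amplification w q).[0] = 1.
Proof.
rewrite horner_srj_amplification big1 // => n _.
by rewrite mulr0 subr0 expr1n.
Qed.

Lemma srj_amplification_node (R : realType) (kmin kmax : R) (M : nat)
    (n : 'I_M) :
  0 < kmin -> kmin < kmax ->
  (srj_amplification (chebyshev_weight kmin kmax (M := M)) (fun=> 1%N))
    .[kappa_node kmin kmax (cos (chebyshev_angle R M n))] = 0.
Proof.
move=> kmin_gt0 lt_k; rewrite horner_srj_amplification (bigD1 n) //=.
by rewrite chebyshev_weightE mulVf ?gt_eqF ?kappa_node_cos_gt0 // subrr mul0r.
Qed.

(** [T] composed with [kappa_tilde], as a polynomial, so that degree and root arguments apply. *)
Definition chebyshev_shift (R : realType) (kmin kmax : R) (T : {poly R}) :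
    {poly R} := T \Po ((2 / (kmax - kmin)) *: ('X - kmin%:P) - 1).

Lemma horner_chebyshev_shift (R : realType) (kmin kmax k : R) (T : {poly R}) :
  (chebyshev_shift kmin kmax T).[k] = T.[kappa_tilde kmin kmax k].
Proof.
rewrite horner_comp; congr (T.[_]); rewrite !hornerE /kappa_tilde.
by rewrite mulrAC -mulrA.
Qed.

Lemma size_chebyshev_shift (R : realType) (kmin kmax : R) (T : {poly R}) M :
  (size T <= M.+1)%N -> (size (chebyshev_shift kmin kmax T) <= M.+1)%N.
Proof.
move=> sT; apply: leq_trans (size_comp_poly_leq _ _) _; rewrite ltnS.
set u := _ - 1; suff su : (size u <= 2)%N.
  rewrite -[leqRHS]muln1 leq_mul //; first by case: (size T) sT.
  by case: (size u) su.
apply: leq_trans (size_polyD _ _) _; rewrite size_polyN geq_max size_poly1 andbT.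
by apply: leq_trans (size_scale_leq _ _) _; rewrite size_XsubC.
Qed.

(** * Closed form and extremality of the Chebyshev scheme *)

Section ChebyshevScheme.
Variables (R : realType) (kmin kmax : R) (M : nat) (T : {poly R}).
Hypotheses (kmin_gt0 : 0 < kmin) (lt_k : kmin < kmax) (M_gt0 : (0 < M)%N).
Hypothesis hT : is_chebyshevT M T.

Let G := srj_amplification (chebyshev_weight kmin kmax (M := M)) (fun=> 1%N).
Let T0 := T.[kappa_tilde kmin kmax 0].

Let size_G : (size G <= M.+1)%N.
Proof.
apply: leq_trans (size_srj_amplification _ _) _.
by rewrite sum1_card card_ord.
Qed.

Lemma chebyshevT_node (n : 'I_M) :
  T.[kappa_tilde kmin kmax (kappa_node kmin kmax (cos (chebyshev_angle R M n)))]
  = 0.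
Proof.
by rewrite kappa_nodeK // (is_chebyshevT_cosN _ hT) cos_chebyshev_angle // mulr0.
Qed.

(** Otherwise 0 would join the [M] nodes as a root of the shifted polynomial and force it to be
    zero; this avoids studying [T] outside [-1, 1]. *)
Lemma chebyshevT_kappa0_neq0 : T0 != 0.
Proof.
apply/eqP => T00.
have H0 : chebyshev_shift kmin kmax T = 0.
  apply: (poly_eq0_at_nodes kmin_gt0 lt_k).
  - exact/size_chebyshev_shift/is_chebyshevT_size.
  - by rewrite horner_chebyshev_shift.
  - by move=> n; rewrite horner_chebyshev_shift chebyshevT_node.
(* Contradiction at [kmax]: there [kappa_tilde] is 1 = cos 0, and [T] takes the value 1. *)
have := horner_chebyshev_shift kmin kmax kmax T; rewrite H0 horner0.
rewrite /kappa_tilde divff ?subr_eq0 ?gt_eqF // mulr1.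
have -> : 2 - 1 = cos 0 :> R by rewrite cos0; ring.
by rewrite hT mulr0 cos0 => /esym/eqP; rewrite oner_eq0.
Qed.

Lemma srj_amplification_chebyshev (k : R) :
  G.[k] = T.[kappa_tilde kmin kmax k] / T0.
Proof.
apply/(mulIf chebyshevT_kappa0_neq0); rewrite divfK ?chebyshevT_kappa0_neq0 //.
(* Both polynomials vanish at the nodes, and multiplying [G] by [T0] makes them agree at 0. *)
suff /(congr1 (horner^~ k)) : T0 *: G - chebyshev_shift kmin kmax T = 0.
  rewrite hornerD hornerN hornerZ horner_chebyshev_shift horner0 => /eqP.
  by rewrite subr_eq0 mulrC => /eqP.
apply: (@poly_eq0_at_nodes _ kmin kmax M) => //.
- apply: leq_trans (size_polyD _ _) _; rewrite size_polyN geq_max.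
  rewrite size_chebyshev_shift ?(is_chebyshevT_size hT) // andbT.
  exact: leq_trans (size_scale_leq _ _) size_G.
- rewrite hornerD hornerN hornerZ horner_chebyshev_shift srj_amplification0.
  by rewrite mulr1 subrr.
- move=> n; rewrite hornerD hornerN hornerZ horner_chebyshev_shift.
  by rewrite srj_amplification_node // chebyshevT_node mulr0 subr0.
Qed.

Lemma max_abs_chebyshev_le : max_abs kmin kmax G <= `|T0|^-1.
Proof.
have [[k k_itv <-] _] := max_abs_attained G (ltW lt_k).
rewrite srj_amplification_chebyshev normrM normfV ler_piMl ?invr_ge0 //.
by apply: (is_chebyshevT_norm_le1 hT); exact: kappa_tilde_itv.
Qed.

(** For [j] from 0 to [M] these points run from [kmin] to [kmax] and are the points of
    equioscillation. *)
Let extremum (j : nat) : R := kappa_node kmin kmax (cos (j%:R * (pi / M%:R))).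

Lemma chebyshevT_extremum (j : nat) :
  T.[kappa_tilde kmin kmax (extremum j)] = (-1) ^+ (M + j).
Proof.
have M_neq0 : M%:R != 0 :> R by rewrite pnatr_eq0 -lt0n.
rewrite kappa_nodeK // (is_chebyshevT_cosN _ hT).
have -> : M%:R * (j%:R * (pi / M%:R)) = 0 + pi *+ j :> R.
  by rewrite -mulr_natl; field.
by rewrite (alternatingn (@cosDpi R)) cos0 mulr1 exprD.
Qed.

(** Cosine decreases on [0, pi] and [kappa_node] reverses order, so the composite increases. *)
Lemma extremum_lt (j k : nat) : (j < k < M.+1)%N -> extremum j < extremum k.
Proof.
move=> /andP[jk kM]; have pi_gt0 := pi_gt0 R.
have MR_gt0 : 0 < M%:R :> R by rewrite ltr0n.
have itv i : (i <= M)%N -> i%:R * (pi / M%:R) \in `[0 : R, pi].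
  move=> iM; rewrite in_itv /= mulrCA; apply/andP; split.
    by apply: mulr_ge0; [exact: ltW|rewrite divr_ge0 ?ler0n].
  by rewrite ler_piMr ?(ltW pi_gt0) // ler_pdivrMr // mul1r ler_nat.
rewrite ltr_kappa_node // ltr_cos ?itv //; last exact: ltnW (leq_trans jk kM).
by rewrite ltr_pM2r ?divr_gt0 // ltr_nat.
Qed.

(** Extremality with uniqueness among all polynomials of degree at most [M] with value 1 at 0,
    whether or not they factor over the reals. *)
Lemma amplification_eq_chebyshev (p : {poly R}) :
  (size p <= M.+1)%N -> p.[0] = 1 -> max_abs kmin kmax p <= max_abs kmin kmax G ->
  p = G.
Proof.
move=> size_p p0 le_pG.
have T0_neq0 := chebyshevT_kappa0_neq0.
have p_le (j : nat) : `|T0 * p.[extremum j]| <= 1.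
  rewrite normrM mulrC -ler_pdivlMr ?normr_gt0 // mul1r.
  apply: le_trans max_abs_chebyshev_le; apply: le_trans le_pG.
  have [_] := max_abs_attained p (ltW lt_k); apply.
  by apply: kappa_node_itv => //; rewrite cos_geN1 cos_le1.
(* Scaling by [s] makes the value of [G] at [extremum j] exactly [(-1) ^+ j]. *)
pose s : R := (-1) ^+ M * T0.
have s_neq0 : s != 0 by rewrite mulf_neq0 ?signr_eq0.
suff /eqP : s *: (G - p) = 0.
  by rewrite scaler_eq0 (negPf s_neq0) subr_eq0 => /eqP.
apply: (@alternating_poly_eq0 _ M.+1 extremum) => //.
- apply: leq_trans (size_scale_leq _ _) _; apply: leq_trans (size_polyD _ _) _.
  by rewrite size_polyN geq_max size_G.
- exact: extremum_lt.
- by move=> j _; apply: kappa_node_cos_gt0.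
- move=> j _; rewrite hornerZ hornerD hornerN srj_amplification_chebyshev.
  rewrite chebyshevT_extremum.
  (* The first term is 1 and the second has absolute value at most 1 by [p_le], so the difference is
     nonnegative. *)
  have -> : (-1) ^+ j * (s * ((-1) ^+ (M + j) / T0 - p.[extremum j])) =
      ((-1) ^+ (M + j)) ^+ 2 - (-1) ^+ (M + j) * (T0 * p.[extremum j]).
    by rewrite /s exprD; field.
  rewrite sqrr_sign subr_ge0; apply: le_trans (ler_norm _) _.
  by rewrite normrM normr_sign mul1r.
- by rewrite hornerZ hornerD hornerN srj_amplification0 p0 subrr mulr0.
Qed.

End ChebyshevScheme.

(** * Fewer distinct weights, and the final assembly *)

(** Equal polynomials share their roots, so each of the [M] distinct Chebyshev weights occurs among
    the [P] values of [w]. *)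
Lemma srj_amplification_chebyshev_neq (R : realType) (kmin kmax : R)
    (M P : nat) (w : 'I_P -> R) (q : 'I_P -> nat) :
  0 < kmin -> kmin < kmax -> (P < M)%N ->
  srj_amplification w q <>
  srj_amplification (chebyshev_weight kmin kmax (M := M)) (fun=> 1%N).
Proof.
move=> kmin_gt0 lt_k; rewrite ltnNge => /negP lt_PM wG; apply: lt_PM.
have w_ex (n : 'I_M) : exists i, w i == chebyshev_weight kmin kmax n.
  have := srj_amplification_node n kmin_gt0 lt_k.
  rewrite -wG horner_srj_amplification => /eqP/prodf_eq0[i _].
  rewrite expf_eq0 => /andP[_]; rewrite subr_eq0 eq_sym => /eqP wi.
  exists i; rewrite chebyshev_weightE -[X in _ == X]mul1r -wi mulfK //.
  by rewrite gt_eqF // kappa_node_cos_gt0.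
(* Choosing an index for each Chebyshev weight injects ['I_M] into ['I_P]. *)
pose f n := xchoose (w_ex n).
have f_inj : injective f.
  move=> j k fjk; apply: (chebyshev_weight_inj lt_k).
  rewrite -(eqP (xchooseP (w_ex j))) -(eqP (xchooseP (w_ex k))).
  by rewrite -/(f j) fjk.
by have := leq_card f f_inj; rewrite !card_ord.
Qed.

Theorem mainTheorem1 (R : realType) (kmin kmax : R) (M : nat) :
  0 < kmin -> kmin < kmax -> (1 <= M)%N ->
  let w : 'I_M -> R := chebyshev_weight kmin kmax (M := M) in
  let G : {poly R} := \prod_(n < M) (1 - w n *: 'X) in
  [/\ forall T : {poly R}, is_chebyshevT M T ->
        forall k : R,
          G.[k] = T.[kappa_tilde kmin kmax k] / T.[kappa_tilde kmin kmax 0],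
      kappa_tilde kmin kmax 0 = - ((1 + kmin / kmax) / (1 - kmin / kmax)),
      kappa_tilde kmin kmax 0 < -1,
      srj_amplification w (fun=> 1%N) = G /\
      srj_optimal kmin kmax M w (fun=> 1%N)
    & forall (P : nat) (w' : 'I_P -> R) (q' : 'I_P -> nat),
        srj_scheme M w' q' ->
        let G' := srj_amplification w' q' in
        (G' <> G -> max_abs kmin kmax G < max_abs kmin kmax G') /\
        ((P < M)%N -> max_abs kmin kmax G < max_abs kmin kmax G')].

Proof.
move=> kmin_gt0 lt_k M_gt0 w G.
have GE : srj_amplification w (fun=> 1%N) = G by [].
(* Optimality does not mention a Chebyshev polynomial, but its proof needs one. *)
have [T hT] := is_chebyshevT_ex R M.
have d_gt0 : 0 < kmax - kmin by rewrite subr_gt0.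
have kmax_gt0 : 0 < kmax := lt_trans kmin_gt0 lt_k.
have kappa0E : kappa_tilde kmin kmax 0 = - ((1 + kmin / kmax) / (1 - kmin / kmax)).
  by rewrite /kappa_tilde; field; rewrite !gt_eqF.
have strict (P : nat) (w' : 'I_P -> R) (q' : 'I_P -> nat) :
    srj_scheme M w' q' -> srj_amplification w' q' <> G ->
    max_abs kmin kmax G < max_abs kmin kmax (srj_amplification w' q').
  move=> [_ _ _ sum_q] G'G; rewrite ltNge; apply/negP => le_G'G; apply: G'G.
  rewrite -GE; apply: (amplification_eq_chebyshev kmin_gt0 lt_k M_gt0 hT) => //.
    by rewrite -[in leqRHS]sum_q size_srj_amplification.
  exact: srj_amplification0.
split.
- move=> S hS k; rewrite -GE; exact: srj_amplification_chebyshev.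
- exact: kappa0E.
- rewrite /kappa_tilde sub0r mulNr mulrN ltrBlDr addNr oppr_lt0.
  by rewrite mulr_gt0 ?divr_gt0.
- split=> //; split.
    split=> //; first by rewrite M_gt0 leqnn.
      exact: chebyshev_weight_inj.
    by rewrite sum1_card card_ord.
  move=> P w' q' hw'; rewrite GE.
  (* Either the polynomials coincide, with equal maxima, or the strict bound applies. *)
  have [->//|/eqP G'G] := eqVneq (srj_amplification w' q') G.
  exact/ltW/strict.
- move=> P w' q' hw' G'; split=> [|lt_PM]; first exact: strict.
  apply: strict hw' _; rewrite -GE.
  exact: srj_amplification_chebyshev_neq.
Qed.
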